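(* Let $p,q>0$ be real with $0<\dfrac{q}{p}<1$, let $f$ be a (real- or complex-valued) function on $(0,\infty)$ and let $A>0$. If $|f(x)x^\alpha|$ is bounded on the interval $(0,A]$ for some $0\leq \alpha<1$, then the $(p,q)$-integral $$(p-q)x\sum_{k=0}^{\infty}\frac{q^{k}}{p^{k+1}}f\left(\frac{q^{k}}{p^{k+1}}x\right)$$ converges to a function $F(x)$ on $(0,A]$, which is a $(p,q)$-antiderivative of $f(x)$ on $(0,A]$, i.e. $D_{p,q}F(x)=f(x)$ for $x\in(0,A]$. Moreover, $F(x)$ is continuous (from the right) at $x=0$ with $F(0)=0$.
   Context: The $(p,q)$-derivative is $D_{p,q}F(x)=\dfrac{F(px)-F(qx)}{(p-q)x}$ for $x\neq 0$. $F$ is understood to be defined by the displayed series at every $x>0$ where it converges (so that $F(px)$ makes sense even if $px>A$), and $F(0)=0$ is the value given by the formula at $x=0$. *)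

(* Defs.v *)
From Stdlib Require Import Reals.
From Coquelicot Require Import Coquelicot.
Open Scope R_scope.

Inductive scalar_field : Set := RealScalars | ComplexScalars.

(* Both targets are real vector spaces: the factors multiplying f below are
   all real. The norm on C is the modulus, see [norm_complex_scalars]. *)
Definition scalars (K : scalar_field) : CompleteNormedModule R_AbsRing :=
  match K with
  | RealScalars => R_CompleteNormedModule
  | ComplexScalars => C_R_CompleteNormedModule
  end.

Coercion scalars : scalar_field >-> CompleteNormedModule.

Lemma norm_real_scalars (x : scalars RealScalars) :
  norm x = Rabs x.
Proof. reflexivity. Qed.

Lemma norm_complex_scalars (z : scalars ComplexScalars) :
  norm z = Cmod z.
Proof.
  destruct z as [a b]; unfold Cmod; cbn.
  change (sqrt (Rabs a * (Rabs a * 1) + Rabs b * (Rabs b * 1))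
          = sqrt (a * (a * 1) + b * (b * 1))).
  f_equal.
  rewrite !Rmult_1_r, <- !Rabs_mult.
  rewrite !Rabs_right; [reflexivity | | ]; apply Rle_ge, Rle_0_sqr.
Qed.

Definition pq_derivative {V : CompleteNormedModule R_AbsRing} (p q : R)
    (F : R -> V) (x : R) : V :=
  scal (/ ((p - q) * x)) (minus (F (p * x)) (F (q * x))).

Definition pq_term {V : CompleteNormedModule R_AbsRing} (p q : R)
    (f : R -> V) (x : R) (k : nat) : V :=
  scal (q ^ k / p ^ (k + 1)) (f (q ^ k / p ^ (k + 1) * x)).

Definition pq_integral_converges {V : CompleteNormedModule R_AbsRing} (p q : R)
    (f : R -> V) (x : R) : Prop :=
  ex_series (pq_term p q f x).

(* [iota] selects the sum of the series; its value is meaningful only when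
   [pq_integral_converges p q f x] holds. At x = 0 the prefactor makes the
   expression zero, whatever value f takes there. *)
Definition pq_integral {V : CompleteNormedModule R_AbsRing} (p q : R)
    (f : R -> V) (x : R) : V :=
  scal ((p - q) * x) (iota (is_series (pq_term p q f x))).

(* Main.v *)
(** At the nodes y_k = q^k/p^(k+1) x the hypothesis gives
    |y_k f(y_k)| <= M y_k^(1-alpha). Since 1 - alpha > 0 and q/p < 1, as soon as
    all nodes lie in (0, A] the series is dominated by a geometric one of ratio
    (q/p)^(1-alpha), so that F(x) = O(x^(1-alpha)) at 0+.
    Dropping the first term of the series at x gives q/p times the series at
    (q/p)x; this extends the convergence to every x > 0, and turns
    F(px) - F(qx) into the single term (p-q) x f(x). *)
Require Import Defs.
From Stdlib Require Import Reals Lra.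
From Coquelicot Require Import Coquelicot.
Open Scope R_scope.

(** * Series, real powers and scalar identities *)

Lemma is_series_norm_le {K : AbsRing} {V : NormedModule K}
    (a : nat -> V) (b : nat -> R) (la : V) (lb : R) :
  (forall n, norm (a n) <= b n) -> is_series a la -> is_series b lb ->
  norm la <= lb.
Proof.
  intros Hab Ha Hb.
  (* The triangle inequality bounds the partial sums; the bound survives the limit because the norm
     is continuous. *)
  apply (is_lim_seq_le (fun n => norm (sum_n a n)) (sum_n b) (norm la) lb).
  - intros n.
    eapply Rle_trans; [apply norm_sum_n_m | apply sum_n_m_le, Hab].
  - apply (filterlim_comp _ _ _ (sum_n a) norm _ (locally la));
      [exact Ha | apply filterlim_norm].
  - exact Hb.
Qed.

Lemma iota_is_series {K : AbsRing} {V : CompleteNormedModule K}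
    (a : nat -> V) (l : V) :
  is_series a l -> iota (is_series a) = l.
Proof. exact (iota_filterlim_locally (sum_n a) l). Qed.

Lemma Rpower_pow_base (r b : R) (k : nat) :
  0 < r -> Rpower (r ^ k) b = Rpower r b ^ k.
Proof.
  intros Hr; induction k as [|k IH]; simpl.
  - unfold Rpower; rewrite ln_1, Rmult_0_r; apply exp_0.
  - rewrite <- IH, Rpower_mult_distr; auto using pow_lt.
Qed.

Lemma Rpower_lt_1 (r b : R) : 0 < r < 1 -> 0 < b -> Rpower r b < 1.
Proof.
  intros Hr Hb.
  replace 1 with (Rpower 1 b) by
    (unfold Rpower; rewrite ln_1, Rmult_0_r; apply exp_0).
  now apply Rlt_Rpower_l.
Qed.

Lemma plus_plus_opp_r {G : AbelianGroup} (u v : G) :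
  plus (plus u v) (opp v) = u.
Proof. now rewrite <- plus_assoc, plus_opp_r, plus_zero_r. Qed.

(** The algebra behind D_{p,q} F = f: [u] is the sum of the series at qx, [v] is f(x), [a] =
    1/((p-q)x), [b] and [e] are the prefactors of F at px and qx, [c] = q/p and [d] = 1/p. *)
Lemma scal_minus_cancel {V : ModuleSpace R_Ring} (a b c d e : R) (u v : V) :
  b * c = e -> a * b * d = 1 ->
  scal a (minus (scal b (plus (scal c u) (scal d v))) (scal e u)) = v.
Proof.
  intros Hbc Habd; unfold minus.
  rewrite scal_distr_l, !scal_assoc.
  change (mult b c) with (b * c); rewrite Hbc.
  rewrite (plus_comm (scal e u)).
  transitivity (scal a (scal (b * d) v)).
  - f_equal; exact (plus_plus_opp_r _ _).
  - rewrite scal_assoc.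
    change (mult a (b * d)) with (a * (b * d)).
    rewrite <- Rmult_assoc, Habd; exact (scal_one v).
Qed.

Lemma norm_scal_R_le {V : NormedModule R_AbsRing} (c : R) (v : V) :
  0 <= c -> norm (scal c v) <= c * norm v.
Proof.
  intros Hc; rewrite <- (Rabs_pos_eq c Hc) at 2.
  apply (norm_scal (K := R_AbsRing)).
Qed.

Lemma norm_scal_Rpower_le {V : NormedModule R_AbsRing} (v : V)
    (y alpha M : R) :
  0 < y -> norm (scal (Rpower y alpha) v) <= M ->
  norm (scal y v) <= M * Rpower y (1 - alpha).
Proof.
  intros Hy HM.
  replace (scal y v)
    with (scal (Rpower y (1 - alpha)) (scal (Rpower y alpha) v)).
  - assert (0 < Rpower y (1 - alpha)) by apply exp_pos.
    eapply Rle_trans; [apply norm_scal_R_le; lra|].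
    rewrite Rmult_comm; apply Rmult_le_compat_r; lra.
  - rewrite scal_assoc; f_equal.
    change (Rpower y (1 - alpha) * Rpower y alpha = y).
    rewrite <- Rpower_plus.
    replace (1 - alpha + alpha) with 1 by ring.
    now apply Rpower_1.
Qed.

(** * Shift relation of the series and the antiderivative property *)

Section PQIntegral.

Context {V : CompleteNormedModule R_AbsRing}.
Variables (p q : R) (f : R -> V).
Hypotheses (Hp : 0 < p) (Hq : 0 < q) (Hqp : q < p).

Lemma pq_ratio_bounds : 0 < q / p < 1.
Proof.
  split; [now apply Rdiv_lt_0_compat|].
  apply Rmult_lt_reg_r with p; [assumption|].
  replace (q / p * p) with q by (field; lra); lra.
Qed.

Lemma pq_node (x : R) (k : nat) :
  q ^ k / p ^ (k + 1) * x = (q / p) ^ k * (x / p).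
Proof.
  unfold Rdiv; rewrite pow_add, Rpow_mult_distr, pow_inv, pow_1; field.
  split; [lra | apply pow_nonzero; lra].
Qed.

Lemma pq_term_0 (x : R) : pq_term p q f (p * x) 0 = scal (/ p) (f x).
Proof.
  unfold pq_term; simpl; f_equal; [|f_equal]; field; lra.
Qed.

Lemma pq_term_succ (x : R) (k : nat) :
  pq_term p q f x (S k) = scal (q / p) (pq_term p q f (q / p * x) k).
Proof.
  assert (p ^ (k + 1) <> 0) by (apply pow_nonzero; lra).
  unfold pq_term; rewrite scal_assoc; simpl; f_equal; [|f_equal].
  - change (q * q ^ k / (p * p ^ (k + 1)) = q / p * (q ^ k / p ^ (k + 1))).
    field; split; lra.
  - field; split; lra.
Qed.

Lemma pq_integral_eq (x : R) (l : V) :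
  is_series (pq_term p q f x) l -> pq_integral p q f x = scal ((p - q) * x) l.
Proof. intros Hl; unfold pq_integral; now rewrite (iota_is_series _ _ Hl). Qed.

Lemma pq_integral_0 : pq_integral p q f 0 = zero.
Proof. unfold pq_integral; rewrite Rmult_0_r; exact (scal_zero_l _). Qed.

Lemma pq_integral_converges_ratio (x : R) :
  pq_integral_converges p q f (q / p * x) -> pq_integral_converges p q f x.
Proof.
  intros H; apply ex_series_incr_1.
  apply ex_series_ext with (2 := ex_series_scal (q / p) _ H).
  intros k; symmetry; apply pq_term_succ.
Qed.

Lemma pq_integral_converges_ratio_pow (n : nat) (x : R) :
  pq_integral_converges p q f ((q / p) ^ n * x) ->
  pq_integral_converges p q f x.
Proof.
  revert x; induction n as [|n IH]; intros x H.
  - now rewrite pow_O, Rmult_1_l in H.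
  - apply pq_integral_converges_ratio, IH.
    replace ((q / p) ^ n * (q / p * x)) with ((q / p) ^ S n * x)
      by (simpl; ring).
    exact H.
Qed.

(** Convergence at qx suffices: since (q/p)(px) = qx, the series at px is its first term f(x)/p
    followed by q/p times the series at qx. *)
Lemma pq_derivative_pq_integral (x : R) :
  x <> 0 -> pq_integral_converges p q f (q * x) ->
  pq_derivative p q (pq_integral p q f) x = f x.
Proof.
  intros Hx [l Hl].
  assert (Hl' : is_series (pq_term p q f (p * x))
                  (plus (scal (q / p) l) (scal (/ p) (f x)))).
  { apply is_series_decr_1; rewrite pq_term_0.
    (* The tail must sum to the claimed total minus the first term, which cancels to
       [scal (q / p) l]. *)
    refine (eq_ind_r (is_series (fun k => pq_term p q f (p * x) (S k)))
              _ (plus_plus_opp_r _ _)).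
    apply is_series_ext with (2 := is_series_scal (q / p) _ _ Hl).
    intros k; rewrite pq_term_succ; do 2 f_equal; field; lra. }
  unfold pq_derivative.
  rewrite (pq_integral_eq _ _ Hl), (pq_integral_eq _ _ Hl').
  apply (scal_minus_cancel (V := V)); field; lra.
Qed.

(** * Geometric domination, convergence and behaviour at 0; [beta] stands for 1 - alpha *)

Section Bounded.

Variables (A beta M : R).
Hypotheses (HA : 0 < A) (Hbeta : 0 < beta)
  (Hf : forall y, 0 < y <= A -> norm (scal y (f y)) <= M * Rpower y beta).

(** The majorant of the term k = 0, whose node is x/p. *)
Let bound (x : R) : R := M / x * Rpower (x / p) beta.

(** The coefficient q^k/p^(k+1) is y_k/x, so the term is y_k f(y_k)/x and [Hf] applies at y_k. The
    nodes decrease from y_0 = x/p, so [x / p <= A] puts them all in (0, A]. *)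
Lemma norm_pq_term_le (x : R) (k : nat) :
  0 < x -> x / p <= A ->
  norm (pq_term p q f x k) <= bound x * Rpower (q / p) beta ^ k.
Proof.
  intros Hx HxA.
  pose proof pq_ratio_bounds as Hr.
  assert (Hxp : 0 < x / p) by now apply Rdiv_lt_0_compat.
  assert (Hrk : 0 < (q / p) ^ k) by (apply pow_lt; lra).
  assert (Hrk1 : (q / p) ^ k <= 1).
  { rewrite <- (pow1 k); apply pow_incr; lra. }
  set (y := (q / p) ^ k * (x / p)).
  assert (Hy : 0 < y <= A).
  { split; [now apply Rmult_lt_0_compat|].
    apply Rle_trans with (1 * (x / p)); [apply Rmult_le_compat_r|]; lra. }
  replace (pq_term p q f x k) with (scal (/ x) (scal y (f y))).
  - assert (0 < / x) by now apply Rinv_0_lt_compat.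
    eapply Rle_trans; [apply (norm_scal_R_le (V := V)); lra|].
    apply Rle_trans with (/ x * (M * Rpower y beta)).
    { apply Rmult_le_compat_l; [lra | now apply Hf]. }
    unfold y; rewrite <- Rpower_mult_distr, Rpower_pow_base by tauto.
    right; unfold bound; field; lra.
  - unfold pq_term; rewrite pq_node; fold y; rewrite scal_assoc; f_equal.
    change (/ x * y = q ^ k / p ^ (k + 1)).
    unfold y; rewrite <- pq_node; field.
    split; [apply pow_nonzero|]; lra.
Qed.

Lemma is_series_pq_bound (x : R) :
  is_series (fun k => bound x * Rpower (q / p) beta ^ k)
    (bound x * / (1 - Rpower (q / p) beta)).
Proof.
  apply (is_series_scal (V := R_NormedModule) (bound x)), is_series_geom.
  rewrite Rabs_pos_eq by apply Rlt_le, exp_pos.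
  apply Rpower_lt_1; [apply pq_ratio_bounds | assumption].
Qed.

Lemma pq_integral_converges_pos (x : R) :
  0 < x -> pq_integral_converges p q f x.
Proof.
  intros Hx.
  pose proof pq_ratio_bounds as Hr.
  (* The threshold Ap/x is chosen so that (q/p)^N x/p < A: after N shifts the largest node lies
     below A, and domination applies. *)
  destruct (pow_lt_1_zero (q / p)) with (y := A * p / x) as [N HN].
  { rewrite Rabs_pos_eq; lra. }
  { apply Rdiv_lt_0_compat; [apply Rmult_lt_0_compat|]; assumption. }
  specialize (HN N (le_n N)).
  assert (HrN : 0 < (q / p) ^ N) by (apply pow_lt; lra).
  rewrite Rabs_pos_eq in HN by lra.
  apply (pq_integral_converges_ratio_pow N).
  eapply ex_series_le; [|eexists; apply is_series_pq_bound].
  intros k; apply norm_pq_term_le.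
  - now apply Rmult_lt_0_compat.
  - apply (Rmult_lt_compat_r (x / p)) in HN; [|now apply Rdiv_lt_0_compat].
    replace (A * p / x * (x / p)) with A in HN by (field; lra).
    unfold Rdiv in *; lra.
Qed.

(** The prefactor (p-q)x cancels the 1/x in [bound]; only a positive power of x/p remains, which
    gives the limit 0. *)
Lemma norm_pq_integral_le (x : R) :
  0 < x -> x / p <= A ->
  norm (pq_integral p q f x)
    <= (p - q) * M / (1 - Rpower (q / p) beta) * Rpower (x / p) beta.
Proof.
  intros Hx HxA.
  destruct (pq_integral_converges_pos x Hx) as [l Hl].
  rewrite (pq_integral_eq _ _ Hl).
  assert (Hn : norm l <= bound x * / (1 - Rpower (q / p) beta)).
  { eapply is_series_norm_le; [|exact Hl | apply is_series_pq_bound].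
    intros k; now apply norm_pq_term_le. }
  assert (Hpqx : 0 < (p - q) * x) by (apply Rmult_lt_0_compat; lra).
  eapply Rle_trans; [apply (norm_scal_R_le (V := V)); lra|].
  eapply Rle_trans; [apply Rmult_le_compat_l, Hn; lra|].
  right; unfold bound; field.
  pose proof (Rpower_lt_1 (q / p) beta pq_ratio_bounds Hbeta); lra.
Qed.

Lemma filterlim_pq_integral_0 :
  filterlim (pq_integral p q f) (at_right 0) (locally (zero : V)).
Proof.
  apply filterlim_locally; intros eps.
  set (C := (p - q) * M / (1 - Rpower (q / p) beta)).
  (* [C'] is strictly positive even if [C] vanishes, so one may divide by it; [d] below solves C'
     d^beta = eps. *)
  set (C' := Rabs C + 1).
  assert (HC : C <= C' /\ 0 < C').
  { unfold C'; pose proof (Rle_abs C); pose proof (Rabs_pos C); lra. }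
  set (d := Rpower (eps / C') (/ beta)).
  (* Below p A the norm estimate is available; below p d it yields a value less than eps. *)
  assert (Hd : 0 < Rmin (p * A) (p * d)).
  { apply Rmin_pos; apply Rmult_lt_0_compat; try assumption; apply exp_pos. }
  assert (Hnear : forall x : R, 0 < x < Rmin (p * A) (p * d) ->
            norm (pq_integral p q f x) < eps).
  2: { exists (mkposreal _ Hd); intros x Hball Hx.
       change (Rabs (x - 0) < Rmin (p * A) (p * d)) in Hball.
       rewrite Rminus_0_r, Rabs_pos_eq in Hball by lra.
       apply (norm_compat1 (V := V)).
       eapply Rle_lt_trans; [right; exact (f_equal norm (minus_zero_r _))|].
       now apply Hnear. }
  intros x [Hx Hball].
  assert (Hxp : 0 < x / p) by now apply Rdiv_lt_0_compat.
  assert (Hdiv : forall z, x < p * z -> x / p < z).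
  { intros z Hz; apply Rmult_lt_reg_l with p; [assumption|].
    replace (p * (x / p)) with x by (field; lra); assumption. }
  assert (HxA : x / p < A)
    by (apply Hdiv; eapply Rlt_le_trans; [exact Hball | apply Rmin_l]).
  assert (Hxd : x / p < d)
    by (apply Hdiv; eapply Rlt_le_trans; [exact Hball | apply Rmin_r]).
  apply Rle_lt_trans with (C * Rpower (x / p) beta).
  { apply norm_pq_integral_le; [assumption | lra]. }
  apply Rle_lt_trans with (C' * Rpower (x / p) beta).
  { apply Rmult_le_compat_r; [apply Rlt_le, exp_pos | lra]. }
  replace (pos eps) with (C' * Rpower d beta).
  { apply Rmult_lt_compat_l; [lra | now apply Rlt_Rpower_l]. }
  unfold d; rewrite Rpower_mult, Rinv_l, Rpower_1 by
    (try apply Rdiv_lt_0_compat; try apply cond_pos; lra).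
  field; lra.
Qed.

End Bounded.

End PQIntegral.

(* f is only constrained and only used on (0, oo); its values elsewhere are
   irrelevant. The points p * x and q * x may exceed A, so the convergence
   of the integral there is asserted as part of D_{p,q} F (x) = f x. *)
Theorem theorem5 :
  forall (K : scalar_field) (p q : R) (f : R -> K) (A alpha : R),
    0 < p -> 0 < q -> 0 < q / p < 1 -> 0 < A ->
    0 <= alpha < 1 ->
    (exists M : R, forall x : R, 0 < x <= A ->
       norm (scal (Rpower x alpha) (f x)) <= M) ->
    (forall x : R, 0 < x <= A -> pq_integral_converges p q f x) /\
    (forall x : R, 0 < x <= A ->
       pq_integral_converges p q f (p * x) /\
       pq_integral_converges p q f (q * x) /\
       pq_derivative p q (pq_integral p q f) x = f x) /\
    pq_integral p q f 0 = zero /\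
    filterlim (pq_integral p q f) (at_right 0) (locally (pq_integral p q f 0)).
Proof.
  intros K p q f A alpha Hp Hq Hr HA Halpha [M HM].
  assert (Hqp : q < p).
  { destruct Hr as [_ Hr].
    apply (Rmult_lt_compat_r p) in Hr; [|assumption].
    replace (q / p * p) with q in Hr by (field; lra); lra. }
  assert (Hf : forall y, 0 < y <= A ->
            norm (scal y (f y)) <= M * Rpower y (1 - alpha)).
  { intros y Hy; apply (norm_scal_Rpower_le (V := K)); [tauto | now apply HM]. }
  assert (Hbeta : 0 < 1 - alpha) by lra.
  (* Convergence is needed on all of (0, oo), since px and qx may exceed A. *)
  assert (Hconv : forall x, 0 < x -> pq_integral_converges p q f x).
  { now apply (pq_integral_converges_pos p q f Hp Hq Hqp A (1 - alpha) M). }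
  repeat split.
  - intros x Hx; apply Hconv, Hx.
  - apply Hconv, Rmult_lt_0_compat; tauto.
  - apply Hconv, Rmult_lt_0_compat; tauto.
  - apply pq_derivative_pq_integral; try assumption; [lra|].
    apply Hconv, Rmult_lt_0_compat; tauto.
  - apply pq_integral_0.
  - rewrite pq_integral_0.
    now apply (filterlim_pq_integral_0 p q f Hp Hq Hqp A (1 - alpha) M).
Qed.
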